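(* Consider a multiobjective linear program with $p$ objectives. The new outer approximation algorithm (the iterative procedure in oriented projective space $\mathbb{T}_p$ described in the context) is correct, i.e. it outputs precisely the efficient extreme outcomes of the multiobjective linear program, and it terminates in finitely many iterations.
   Context: $\mathbb{E}_d$ denotes $d$-dimensional Euclidean space; vector inequalities are componentwise; a polyhedron is an intersection of finitely many closed half-spaces, and a polytope is a bounded polyhedron. Multiobjective linear program: given an $m\times n$ real matrix $A$, $\mathbf b\in\mathbb{R}^m$ and a $p\times n$ real objective matrix $C$, the feasible set $X=\{\mathbf x\in\mathbb{E}_n : A\mathbf x=\mathbf b,\ \mathbf x\ge\mathbf 0\}$ is assumed to be nonempty and bounded, and the outcome set is the polytope $Y^==\{C\mathbf x:\mathbf x\in X\}\subseteq\mathbb{E}_p$. A point $\mathbf y\in Y^=$ is efficient if there is no other $\mathbf y'\in Y^=$, $\mathbf y'\neq\mathbf y$, with $\mathbf y'\ge\mathbf y$; the efficient extreme outcomes are the vertices of $Y^=$ that are efficient. Let $Y^\leq=\{\mathbf z\in\mathbb{E}_p : \mathbf z\le\mathbf y \text{ for some } \mathbf y\in Y^=\}$, an unbounded polyhedron. Oriented projective space $\mathbb{T}_p$: its points are the nonzero vectors of $\mathbb{R}^{p+1}$ (signed homogeneous coordinates), where two vectors represent the same point if and only if each is a positive scalar multiple of the other. A point $(x_1,\ldots,x_{p+1})$ is visible if $x_{p+1}>0$ (and is identified with the Euclidean point $(x_1/x_{p+1},\ldots,x_p/x_{p+1})\in\mathbb{E}_p$), invisible if $x_{p+1}<0$, and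 a point at infinity if $x_{p+1}=0$. A nonzero $\mathbf h\in\mathbb{R}^{p+1}$ defines the projective hyperplane $\{\mathbf x:\mathbf h\cdot\mathbf x=0\}$ and the projective half-space $\{\mathbf x:\mathbf h\cdot\mathbf x\ge0\}$ with that bounding hyperplane and with interior $\{\mathbf x:\mathbf h\cdot\mathbf x>0\}$. The line segment joining distinct non-opposite points $\mathbf x,\mathbf y$ is the set of points $\alpha\mathbf x+\beta\mathbf y$ with $\alpha,\beta\ge0$ not both zero ($\mathbf x$ and $-\mathbf x$ are opposite). For a finite set $V$ of points all lying in the interior of some projective half-space, the convex hull is the set of points whose coordinates are nonnegative, not-all-zero linear combinations of coordinate vectors of the points of $V$; it is called a projective polytope, and if $V$ is minimal (no point can be removed without changing the hull) the points of $V$ are its vertices. $T^\leq$ is the projective polytope in $\mathbb{T}_p$ formed as the convex hull of: (i) the visible points $(v_1,\ldots,v_p,1)$ for every vertex $(v_1,\ldots,v_p)$ of $Y^\leq$; and (ii) the $p$ points at infinity $(-1,0,\ldots,0,0),(0,-1,\ldots,0,0),\ldots,(0,0,\ldots,-1,0)$. New outer approximation algorithm. It constructs projective polytopes $Q_0\supseteq Q_1\supseteq\cdots$ in $\mathbb{T}_p$, each stored both as a convex hull of vertices and as an intersection of projective half-spaces. Initialisation: let $\mathbf y^{\max}$ be the point with coordinates $(y^{\max}_1,\ldots,y^{\max}_p,1)$, where $y^{\max}_i$ is the maximum of the $i$th objective (the $i$th coordinate) over $Y^=$. Choose an arbitrary point $\overline{\mathbf y}$ in the interior of $T^\leq$.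 Let $Q_0$ be the simplex with one visible vertex $\mathbf y^{\max}$ and the $p$ vertices at infinity $(-1,0,\ldots,0,0),\ldots,(0,\ldots,0,-1,0)$. Iteration, constructing $Q_{i+1}$ from $Q_i$: Step 1. Search through the visible vertices of $Q_i$ for one that does not belong to $T^\leq$. If none exists, output all visible vertices of $Q_i$ and terminate. Step 2. Otherwise let $\mathbf v$ be such a vertex, and compute the unique point $\mathbf x$ at which the line segment joining $\mathbf v$ with $\overline{\mathbf y}$ crosses the boundary of $T^\leq$. Step 3. Compute a projective half-space $H\subseteq\mathbb{T}_p$ that contains $T^\leq$ and has $\mathbf x$ in its bounding hyperplane. Step 4. Set $Q_{i+1}=Q_i\cap H$ (computing its half-space and convex hull representations). Choices of $\overline{\mathbf y}$, $\mathbf v$ and $H$ satisfying the stated requirements are arbitrary. *)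

(* Defs.v *)
From HB Require Import structures.
From mathcomp Require Import all_boot all_order all_algebra.
From mathcomp Require Import all_classical all_reals all_analysis.
Set Implicit Arguments.
Unset Strict Implicit.
Unset Printing Implicit Defensive.
Import Order.TTheory GRing.Theory Num.Theory numFieldNormedType.Exports.
Local Open Scope classical_set_scope.
Local Open Scope ring_scope.

Definition vle (R : realType) (k : nat) (x y : 'cV[R]_k) : Prop :=
  forall i, x i 0 <= y i 0.

Definition feasible (R : realType) (m n : nat) (A : 'M[R]_(m, n))
    (b : 'cV[R]_m) : set 'cV[R]_n :=
  [set x | A *m x = b /\ vle 0 x].

Definition outcomes (R : realType) (m n p : nat) (A : 'M[R]_(m, n))
    (b : 'cV[R]_m) (C : 'M[R]_(p, n)) : set 'cV[R]_p :=
  [set C *m x | x in feasible A b].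

Definition efficient (R : realType) (p : nat) (Y : set 'cV[R]_p)
    (y : 'cV[R]_p) : Prop :=
  Y y /\ ~ (exists y', [/\ Y y', y' <> y & vle y y']).

(* Vertices of a polyhedron are its extreme points. *)
Definition vertex (R : realType) (p : nat) (P : set 'cV[R]_p)
    (v : 'cV[R]_p) : Prop :=
  P v /\ forall (x y : 'cV[R]_p) (t : R), P x -> P y -> 0 < t < 1 ->
    v = t *: x + (1 - t) *: y -> x = v /\ y = v.

Definition efficient_extreme (R : realType) (p : nat) (Y : set 'cV[R]_p) :
    set 'cV[R]_p :=
  [set y | vertex Y y /\ efficient Y y].

Definition down_closure (R : realType) (p : nat) (Y : set 'cV[R]_p) :
    set 'cV[R]_p :=
  [set z | exists2 y, Y y & vle z y].

Definition is_ideal_point (R : realType) (p : nat) (Y : set 'cV[R]_p)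
    (ymax : 'cV[R]_p) : Prop :=
  forall i, (exists2 y, Y y & y i 0 = ymax i 0) /\
            (forall y, Y y -> y i 0 <= ymax i 0).

(* Oriented projective space T_p:
   A point of T_p is a nonzero vector of R^(p+1) taken up to [same_point].
   A subset of T_p is represented by the union of the corresponding open
   rays, i.e. by a set of nonzero vectors that is closed under positive
   scaling.  The quotient map from R^(p+1) \ {0} to T_p is open and continuous,
   hence the interior and the boundary in T_p are represented by the interior
   and the boundary in R^(p+1) \ {0}. *)

Definition same_point (R : realType) (p : nat) (x y : 'cV[R]_(p + 1)) : Prop :=
  exists2 c : R, 0 < c & x = c *: y.

Definition last_coord (R : realType) (p : nat) (x : 'cV[R]_(p + 1)) : R :=
  x (rshift p ord0) 0.

Definition visible (R : realType) (p : nat) (x : 'cV[R]_(p + 1)) : Prop :=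
  0 < last_coord x.

Definition homog (R : realType) (p : nat) (y : 'cV[R]_p) : 'cV[R]_(p + 1) :=
  col_mx y 1%:M.

Definition dehomog (R : realType) (p : nat) (x : 'cV[R]_(p + 1)) : 'cV[R]_p :=
  (last_coord x)^-1 *: usubmx x.

(* The point at infinity (0, .., 0, -1, 0, .., 0; 0). *)
Definition neg_infty (R : realType) (p : nat) (i : 'I_p) : 'cV[R]_(p + 1) :=
  col_mx (- delta_mx i 0) 0.

Definition dot (R : realType) (k : nat) (h x : 'cV[R]_k) : R :=
  \sum_i h i 0 * x i 0.

Definition phalfspace (R : realType) (p : nat) (h : 'cV[R]_(p + 1)) :
    set 'cV[R]_(p + 1) :=
  [set x | x != 0 /\ 0 <= dot h x].

Definition psegment (R : realType) (p : nat) (x y : 'cV[R]_(p + 1)) :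
    set 'cV[R]_(p + 1) :=
  [set z | exists a b : R,
     [/\ 0 <= a, 0 <= b, (a != 0) || (b != 0) & z = a *: x + b *: y]].

Definition phull (R : realType) (p : nat) (V : set 'cV[R]_(p + 1)) :
    set 'cV[R]_(p + 1) :=
  [set x | exists (k : nat) (a : 'I_k -> R) (v : 'I_k -> 'cV[R]_(p + 1)),
     [/\ forall i, V (v i), forall i, 0 <= a i, exists i, a i != 0
       & x = \sum_i a i *: v i]].

Definition pboundary (R : realType) (p : nat) (T : set 'cV[R]_(p + 1)) :
    set 'cV[R]_(p + 1) :=
  [set x | x != 0 /\ (closure T `\` interior T) x].

(* [V] lists coordinate vectors of the vertices of the projective polytope
   [phull [set` V]]; minimality is about removing a point, not just one of the
   coordinate vectors that may represent it. *)
Definition is_vertex_list (R : realType) (p : nat) (V : seq 'cV[R]_(p + 1)) :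
    Prop :=
  (exists2 h : 'cV[R]_(p + 1), h != 0 & forall v, v \in V -> 0 < dot h v) /\
  (forall v, v \in V ->
     phull [set w | w \in V /\ ~ same_point w v] <> phull [set` V]).

Definition Tle (R : realType) (p : nat) (Y : set 'cV[R]_p) :
    set 'cV[R]_(p + 1) :=
  phull ([set homog v | v in vertex (down_closure Y)]
         `|` range (@neg_infty R p)).

(* The two stored representations of a projective polytope: coordinate vectors
   of its vertices, and the vectors defining the half-spaces. *)
Record state (R : realType) (p : nat) := State {
  verts : seq 'cV[R]_(p + 1);
  normals : seq 'cV[R]_(p + 1)
}.

Definition polytope_of (R : realType) (p : nat) (s : state R p) :
    set 'cV[R]_(p + 1) :=
  phull [set` verts s].

Definition represents (R : realType) (p : nat) (s : state R p)
    (Q : set 'cV[R]_(p + 1)) : Prop :=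
  [/\ is_vertex_list (verts s),
      polytope_of s = Q,
      forall h, h \in normals s -> h != 0
    & [set x | x != 0 /\ forall h, h \in normals s -> phalfspace h x] = Q].

Definition initial (R : realType) (p : nat) (Y : set 'cV[R]_p)
    (s : state R p) : Prop :=
  exists2 ymax, is_ideal_point Y ymax &
    represents s (phull (homog ymax |` range (@neg_infty R p))).

Definition candidate (R : realType) (p : nat) (T : set 'cV[R]_(p + 1))
    (s : state R p) (v : 'cV[R]_(p + 1)) : Prop :=
  [/\ v \in verts s, visible v & ~ T v].

Definition crossing (R : realType) (p : nat)
    (T : set 'cV[R]_(p + 1)) (ybar v x : 'cV[R]_(p + 1)) : Prop :=
  psegment v ybar x /\ pboundary T x.

Definition supporting (R : realType) (p : nat)
    (T : set 'cV[R]_(p + 1)) (x h : 'cV[R]_(p + 1)) : Prop :=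
  [/\ h != 0, T `<=` phalfspace h & dot h x = 0].

Definition cut (R : realType) (p : nat) (s : state R p) (h : 'cV[R]_(p + 1))
    (s' : state R p) : Prop :=
  represents s' (polytope_of s `&` phalfspace h).

Definition step (R : realType) (p : nat) (T : set 'cV[R]_(p + 1))
    (ybar : 'cV[R]_(p + 1)) (s s' : state R p) : Prop :=
  exists v x h, [/\ candidate T s v, crossing T ybar v x,
                    supporting T x h & cut s h s'].

Inductive reachable (R : realType) (p : nat) (Y : set 'cV[R]_p)
    (ybar : 'cV[R]_(p + 1)) : state R p -> Prop :=
| reachable_init s : initial Y s -> reachable Y ybar s
| reachable_step s s' :
    reachable Y ybar s -> step (Tle Y) ybar s s' -> reachable Y ybar s'.

Definition output (R : realType) (p : nat) (s : state R p) : set 'cV[R]_p :=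
  [set dehomog v | v in [set v | v \in verts s /\ visible v]].

Definition init_executable (R : realType) (p : nat) (Y : set 'cV[R]_p) : Prop :=
  (exists ybar, interior (Tle Y) ybar) /\ (exists s, initial Y s).

(* The segment is defined, the crossing point exists and is unique, and for any
   admissible choices a half-space and then the next state exist. *)
Definition steps_executable (R : realType) (p : nat) (T : set 'cV[R]_(p + 1))
    (ybar : 'cV[R]_(p + 1)) (s : state R p) : Prop :=
  forall v, candidate T s v ->
    [/\ ~ same_point v ybar /\ ~ same_point v (- ybar),
        exists2 x, crossing T ybar v x &
          forall x', crossing T ybar v x' -> same_point x' x
      & forall x, crossing T ybar v x ->
          (exists h, supporting T x h) /\
          (forall h, supporting T x h -> exists s', cut s h s')].

Definition terminates (R : realType) (p : nat) (Y : set 'cV[R]_p)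
    (ybar : 'cV[R]_(p + 1)) : Prop :=
  ~ exists run : nat -> state R p,
      initial Y (run 0%N) /\
      forall i, step (Tle Y) ybar (run i) (run i.+1).

(* Main.v *)
(* Homogenising, [Y^<=] becomes a finitely generated pointed cone whose nonzero
   vectors form [T^<=]: its extreme rays are spanned by the vertices of [Y^<=],
   which are exactly the efficient extreme outcomes, and by points at infinity.
   By the Minkowski-Weyl theorem each cone has both representations, so every
   step can be executed, and a boundary point of [T^<=] lies on a facet.
   Termination: a normal [h] chosen at a crossing point [x] vanishes on the
   generators of [T^<=] in the support of [x].  Every later vertex [v] satisfies
   [0 <= dot h v] while [ybar] is interior, so [h] is positive at every later
   crossing point, which therefore has a different support; there are only
   finitely many supports.
   Output: all points at infinity of [Q_0] belong to [T^<=], so if all visible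
   vertices of [Q_i] do as well, then [Q_i = T^<=], and the visible vertices are
   the extreme rays of [T^<=] through vertices of [Y^<=]. *)
Require Import Defs.
From HB Require Import structures.
From mathcomp Require Import all_boot all_order all_algebra.
From mathcomp Require Import all_classical all_reals all_analysis.
From mathcomp Require Import lra ring.
Import Order.TTheory GRing.Theory Num.Theory numFieldNormedType.Exports.
Set Implicit Arguments.
Unset Strict Implicit.
Unset Printing Implicit Defensive.
Local Open Scope classical_set_scope.
Local Open Scope ring_scope.

(** * Finitely generated cones *)

Section Cones.
Variables (R : realType) (k : nat).
Implicit Types (x y z g h : 'cV[R]_k) (G L : seq 'cV[R]_k).

Lemma dotC h x : dot h x = dot x h.
Proof. by apply: eq_bigr => i _; rewrite mulrC. Qed.

Lemma dotDr h x y : dot h (x + y) = dot h x + dot h y.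
Proof.
by rewrite /dot -big_split; apply: eq_bigr => i _; rewrite mxE mulrDr.
Qed.

Lemma dotZr h (a : R) x : dot h (a *: x) = a * dot h x.
Proof.
by rewrite /dot mulr_sumr; apply: eq_bigr => i _; rewrite mxE mulrCA.
Qed.

Lemma dot0r h : dot h 0 = 0.
Proof. by rewrite -(scale0r 0) dotZr mul0r. Qed.

Lemma dotBr h x y : dot h (x - y) = dot h x - dot h y.
Proof. by rewrite -scaleN1r dotDr dotZr mulN1r. Qed.

Lemma dotZl (a : R) h x : dot (a *: h) x = a * dot h x.
Proof. by rewrite dotC dotZr (dotC x). Qed.

Lemma dotBl g h x : dot (g - h) x = dot g x - dot h x.
Proof. by rewrite dotC dotBr !(dotC x). Qed.

Lemma dotNl h x : dot (- h) x = - dot h x.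
Proof. by rewrite -scaleN1r dotZl mulN1r. Qed.

Lemma dot_delta i x : dot (delta_mx i 0) x = x i 0.
Proof.
rewrite /dot (bigD1 i) //= big1 ?addr0 ?mxE ?eqxx ?mul1r // => j ji.
by rewrite mxE (negPf ji) mul0r.
Qed.

Lemma dot_sqr_gt0 h : h != 0 -> 0 < dot h h.
Proof.
move=> h0; have ge0 i : true -> 0 <= h i 0 * h i 0 by rewrite -expr2 sqr_ge0.
rewrite lt_neqAle sumr_ge0 ?andbT //; apply: contraNneq h0 => /esym hh.
apply/eqP/colP => i; rewrite mxE; apply/eqP.
by have /eqP := @psumr_eq0P _ _ _ _ ge0 hh i isT; rewrite mulf_eq0 orbb.
Qed.

Lemma seq_argmax (T : eqType) (f : T -> R) (s : seq T) : s != [::] ->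
  exists2 w, w \in s & forall w', w' \in s -> f w' <= f w.
Proof.
elim: s => // a [|b s] IH _; first by exists a => [|w]; rewrite !inE // => /eqP->.
have [//|w ws wmax] := IH.
have [le|lt] := leP (f a) (f w).
  exists w => [|w']; first by rewrite inE ws orbT.
  by rewrite inE => /orP[/eqP->|/wmax].
exists a => [|w']; first by rewrite inE eqxx.
by rewrite inE => /orP[/eqP->//|/wmax le]; rewrite (le_trans le) // ltW.
Qed.

Definition hcone L x : Prop := forall h, h \in L -> 0 <= dot h x.

(** The cone generated by [G]. Peeling off one generator at a time lets an induction on [G]
    eliminate one coefficient per step. *)
Fixpoint incone G x : Prop :=
  if G is g :: G' then exists2 t : R, 0 <= t & incone G' (x - t *: g)
  else x = 0.

Definition convex_cone (P : set 'cV[R]_k) : Prop :=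
  [/\ P 0, forall x y, P x -> P y -> P (x + y)
    & forall (a : R) x, 0 <= a -> P x -> P (a *: x)].

Lemma hcone_cone L : convex_cone (hcone L).
Proof.
split=> [h _|x y Lx Ly h hL|a x a0 Lx h hL]; rewrite ?dot0r ?dotDr ?dotZr //.
  by rewrite addr_ge0 ?Lx ?Ly.
by rewrite mulr_ge0 ?Lx.
Qed.

Lemma incone_cone G : convex_cone (incone G).
Proof.
elim: G => [|g G [G0 GD GZ]].
  by split=> //= [x y -> ->|a x _ ->]; rewrite ?addr0 ?scaler0.
split=> /=.
- by exists 0; rewrite // scale0r subr0.
- move=> x y [s s0 xs] [t t0 yt]; exists (s + t); first exact: addr_ge0.
  by rewrite scalerDl opprD addrACA; apply: GD.
- move=> a x a0 [s s0 xs]; exists (a * s); first exact: mulr_ge0.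
  by rewrite -scalerA -scalerBr; apply: GZ.
Qed.

Lemma incone_min (P : set 'cV[R]_k) G x :
  convex_cone P -> (forall g, g \in G -> P g) -> incone G x -> P x.
Proof.
move=> [P0 PD PZ]; elim: G x => [|g G IH] x GP /= => [->//|[t t0 Gx]].
rewrite -(subrK (t *: g) x); apply: PD.
  by apply: IH Gx => h hG; apply: GP; rewrite inE hG orbT.
by apply: PZ => //; apply: GP; rewrite inE eqxx.
Qed.

Lemma mem_incone G g : g \in G -> incone G g.
Proof.
elim: G => //= a G IH; rewrite inE; have [G0 _ _] := incone_cone G.
case/orP=> [/eqP->|gG]; first by exists 1; rewrite // scale1r subrr.
by exists 0; rewrite // scale0r subr0; apply: IH.
Qed.

Lemma incone_sub G G' x :
  (forall g, g \in G -> incone G' g) -> incone G x -> incone G' x.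
Proof. exact: incone_min (incone_cone G'). Qed.

Lemma incone_cat G G' x : incone (G ++ G') x ->
  exists y z, [/\ incone G y, incone G' z & x = y + z].
Proof.
elim: G x => [|g G IH] x /=; first by exists 0, x; rewrite add0r.
case=> t t0 /IH [y [z [Gy Gz xyz]]]; exists (y + t *: g), z; split=> //.
  by exists t; rewrite // addrK.
by rewrite addrAC -xyz subrK.
Qed.

(* One step of Fourier-Motzkin elimination. *)
Lemma hcone_add_ray L g : exists L', forall x,
  hcone L' x <-> exists2 t : R, 0 <= t & hcone L (x - t *: g).
Proof.
pose P := [seq h <- L | 0 < dot h g]; pose N := [seq h <- L | dot h g < 0].
exists ([seq h <- L | 0 <= dot h g] ++
  [seq dot h1 g *: h2 - dot h2 g *: h1 | h1 <- P, h2 <- N]) => x; split.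
- move=> Lx.
  have Lx1 h : h \in L -> 0 <= dot h g -> 0 <= dot h x.
    by move=> hL hg; apply: Lx; rewrite mem_cat mem_filter hg hL.
  have Lx2 h1 h2 : h1 \in L -> h2 \in L -> 0 < dot h1 g -> dot h2 g < 0 ->
      0 <= dot h1 g * dot h2 x - dot h2 g * dot h1 x.
    move=> h1L h2L h1g h2g; rewrite -!dotZl -dotBl; apply: Lx.
    rewrite mem_cat; apply/orP; right; apply/allpairsP; exists (h1, h2).
    by rewrite !mem_filter h1L h2L h1g h2g.
  (* For [dot h g < 0] the constraint on [x - t *: g] reads [dot h x / dot h g <= t]; the witness is
     the largest of these lower bounds and [0]. *)
  pose S := 0 :: [seq dot h x / dot h g | h <- N].
  have [t tS tmax] := @seq_argmax R id S isT.
  exists t => [|h hL]; first by apply: tmax; rewrite inE eqxx.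
  rewrite dotBr dotZr subr_ge0.
  have [hg|hg] := ltP (dot h g) 0.
    rewrite -ler_ndivrMr // tmax // inE; apply/orP; right.
    by apply/mapP; exists h; rewrite ?mem_filter ?hg.
  move: tS; rewrite inE => /orP[/eqP->|/mapP[h2]]; first by rewrite mul0r Lx1.
  rewrite mem_filter => /andP[h2g h2L] ->.
  move: hg; rewrite le_eqVlt => /orP[/eqP hg|hg].
    by rewrite -hg mulr0; apply: Lx1 => //; rewrite -hg.
  (* The combined constraint says that the lower bound from [h2] does not exceed the upper bound
     from [h]. *)
  have := Lx2 _ _ hL h2L hg h2g; rewrite subr_ge0 => le.
  by rewrite mulrAC ler_ndivrMr // [leLHS]mulrC [leRHS]mulrC.
- case=> t t0 Lx h; have {}Lx h' : h' \in L -> t * dot h' g <= dot h' x.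
    by move=> /Lx; rewrite dotBr dotZr subr_ge0.
  rewrite mem_cat mem_filter => /orP[/andP[hg hL]|].
    by apply: le_trans (Lx _ hL); rewrite mulr_ge0.
  case/allpairsP=> -[h1 h2]; rewrite !mem_filter /=.
  case=> /andP[h1g h1L] /andP[h2g h2L] ->; rewrite dotBl !dotZl subr_ge0.
  apply: (@le_trans _ _ (dot h1 g * (t * dot h2 g))).
    rewrite [leRHS]mulrCA [leRHS]mulrA [leRHS]mulrC.
    by apply: ler_wnM2l; [exact: ltW | exact: Lx].
  by apply: ler_wpM2l; [exact: ltW | exact: Lx].
Qed.

(** The zero cone is cut out by the coordinates and their negatives; each further generator costs
    one elimination step. *)
Lemma weyl_cone G : exists L, forall x, incone G x <-> hcone L x.
Proof.
elim: G => [|g G [L GL]].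
  exists ([seq delta_mx i 0 | i <- enum 'I_k] ++
          [seq - delta_mx i 0 | i <- enum 'I_k]) => x /=; split=> [->|Lx].
    by case: (hcone_cone ([seq delta_mx i 0 | i <- enum 'I_k] ++
          [seq - delta_mx i 0 | i <- enum 'I_k])).
  apply/colP => i; apply/eqP; rewrite mxE eq_le -oppr_ge0 -!dot_delta -dotNl.
  by rewrite !Lx // mem_cat; apply/orP; [left | right];
    apply/mapP; exists i; rewrite ?mem_enum.
have [L' L'P] := hcone_add_ray L g; exists L' => x; split.
  by case=> t t0 /GL Lx; apply/L'P; exists t.
by move=> /L'P[t t0 /GL Gx]; exists t.
Qed.

Lemma farkas G x :
  (forall h, (forall g, g \in G -> 0 <= dot h g) -> 0 <= dot h x) -> incone G x.
Proof.
have [L GL] := weyl_cone G; move=> Gx; apply/GL => h hL; apply: Gx => g gG.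
by have /GL := mem_incone gG; apply.
Qed.

(** By duality: the normals describing the cone of [L] generate the cone cut out by [L], one
    inclusion being [farkas]. *)
Lemma minkowski_cone L : exists G, forall x, hcone L x <-> incone G x.
Proof.
have [G LG] := weyl_cone L; exists G => x; split=> [Lx|].
  apply: farkas => h Gh; have /LG : hcone G h.
    by move=> g /Gh; rewrite dotC.
  rewrite dotC; apply: (@incone_min [set g | 0 <= dot x g]).
    by have := hcone_cone [:: x]; rewrite /hcone; split=> [|y z|a y] /=;
      rewrite ?dot0r ?dotDr ?dotZr //; [exact: addr_ge0 | exact: mulr_ge0].
  by move=> g /Lx; rewrite dotC.
apply: incone_min; first exact: hcone_cone.
by move=> g gG h /mem_incone/LG /(_ g gG); rewrite dotC.
Qed.

(** Coefficients are indexed by positions in [G]; their nonzero pattern is the support counted in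
    the termination proof. *)
Lemma incone_sum G x : incone G x ->
  exists2 a : 'I_(size G) -> R, forall i, 0 <= a i & x = \sum_i a i *: G`_i.
Proof.
elim: G x => [|g G IH] x /=.
  by move=> ->; exists (fun=> 0) => //; rewrite big_ord0.
case=> t t0 /IH [a a0 xa].
exists (fun i => if unlift ord0 i is Some j then a j else t).
  by move=> i; case: unlift.
rewrite big_ord_recl unlift_none /=.
under eq_bigr do rewrite liftK /=.
by rewrite -xa addrC subrK.
Qed.

Lemma incone_filter0 G x : incone [seq g <- G | g != 0] x <-> incone G x.
Proof.
split; apply: incone_sub => g; first by rewrite mem_filter => /andP[_ /mem_incone].
move=> gG; have [->|g0] := eqVneq g 0; first by case: (incone_cone [seq g <- G | g != 0]).
by apply: mem_incone; rewrite mem_filter g0.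
Qed.

(** The vectors that are zero or pair strictly positively with [h] form a convex cone. Pointedness
    is used in this form throughout. *)
Lemma incone_gt0 G h x : (forall g, g \in G -> 0 < dot h g) ->
  incone G x -> x != 0 -> 0 < dot h x.
Proof.
move=> Gh Gx; pose P := [set x | x = 0 \/ 0 < dot h x].
have [] : P x; [|by move=> ->; rewrite eqxx|by []].
apply: incone_min Gx => [|g gG]; last by right; apply: Gh.
split=> [|y z [->|hy] [->|hz]|a y]; rewrite /P/= ?addr0 ?add0r; try tauto.
  by rewrite dotDr addr_gt0 //; right.
rewrite le_eqVlt => /orP[/eqP<- _|a0 [->|hy]].
- by rewrite scale0r; left.
- by rewrite scaler0; left.
- by rewrite dotZr mulr_gt0 //; right.
Qed.

(* In the pointed cones used here this says that [x] spans an extreme ray. *)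
Definition extreme_ray (P : set 'cV[R]_k) x : Prop :=
  [/\ P x, x != 0 & forall y z, P y -> P z -> x = y + z ->
     exists2 t : R, 0 <= t & y = t *: x].

(** In [x = t *: g + (x - t *: g)] extremality makes [t *: g] a multiple of [x]. If it is zero, [x]
    lies in the cone of the remaining generators; otherwise [g] spans the ray. *)
Lemma extreme_ray_mem (P : set 'cV[R]_k) G x : convex_cone P ->
  (forall g, g \in G -> P g) -> incone G x -> extreme_ray P x ->
  exists2 g, g \in G & exists2 c : R, 0 < c & x = c *: g.
Proof.
move=> [P0 PD PZ] GP Gx [Px x0 ext]; elim: G GP Gx => [|g G IH] GP /=.
  by move=> /eqP; rewrite (negPf x0).
have sGP h : h \in G -> P h by move=> hG; apply: GP; rewrite inE hG orbT.
case=> t t0 Gx.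
have Pg : P (t *: g) by apply: PZ => //; apply: GP; rewrite inE eqxx.
have Px' : P (x - t *: g) by apply: incone_min Gx.
have [|c c0 tg] := ext _ _ Pg Px'; first by rewrite addrC subrK.
have [cE|cN0] := eqVneq c 0.
  have [|g' g'G [d d0 xd]] := IH sGP.
    by move: Gx; rewrite tg cE scale0r subr0.
  by exists g'; [rewrite inE g'G orbT | exists d].
exists g; first by rewrite inE eqxx.
have xE : x = (c^-1 * t) *: g by rewrite -scalerA tg scalerA mulVf // scale1r.
exists (c^-1 * t) => //; rewrite lt_neqAle mulr_ge0 ?invr_ge0 // andbT.
by apply: contraNneq x0 => e; rewrite xE -e scale0r.
Qed.

End Cones.

(** * Linear forms, interiors and closures *)

Lemma near_seq (T : topologicalType) (I : eqType) (s : seq I) (P : I -> set T)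
    (y : T) :
  (forall i, i \in s -> \forall x \near y, P i x) ->
  \forall x \near y, forall i, i \in s -> P i x.
Proof.
elim: s => [|i s IH] sP; first by apply: nearW => x h.
have Pi : \forall x \near y, P i x by apply: sP; rewrite inE eqxx.
have {}IH := IH (fun j js => sP j (@mem_behead _ (i :: s) j js)).
apply: filterS2 Pi IH => x Pix sPx j.
by rewrite inE => /orP[/eqP->//|/sPx].
Qed.

Section Topology.
Variables (R : realType) (k : nat).
Implicit Types (x y h : 'cV[R]_k) (G L : seq 'cV[R]_k).

Lemma weyl_neq0 G : exists2 L, forall h, h \in L -> h != 0 &
  forall x, incone G x <-> hcone L x.
Proof.
have [L GL] := weyl_cone G; exists [seq h <- L | h != 0] => [h|x].
  by rewrite mem_filter => /andP[].
split=> [/GL Lx h|Lx]; first by rewrite mem_filter => /andP[_ /Lx].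
apply/GL => h hL; have [->|h0] := eqVneq h 0; first by rewrite dotC dot0r.
by apply: Lx; rewrite mem_filter h0.
Qed.

Lemma dot_continuous h : continuous (dot h).
Proof.
rewrite /dot => x; have xF := @nbhs_filter _ x.
apply: (@cvg_big _ _ +%R 0 _ (@add_continuous _) _ _ _ _ _ xF) => i _.
by apply: cvgM; [exact: cvg_cst | apply: coord_continuous].
Qed.

Lemma near_dot_gt0 L y : (forall h, h \in L -> 0 < dot h y) ->
  \forall x \near y, forall h, h \in L -> 0 < dot h x.
Proof.
move=> Ly; apply: near_seq => h hL.
exact: (@dot_continuous h y _ (lt_nbhsr (Ly _ hL))).
Qed.

(** A small move from [y] along [- h] stays in [T] and lowers [dot h y] by a positive multiple of
    [dot h h]. *)
Lemma interior_dot_gt0 (T : set 'cV[R]_k) h y : h != 0 ->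
  (forall x, T x -> 0 <= dot h x) -> interior T y -> 0 < dot h y.
Proof.
move=> h0 Th; rewrite /interior/= => Ty.
have lim : (fun t : R => y - t *: h) @ (0 : R) --> y.
  rewrite -[X in _ --> X]subr0 -(scale0r h).
  by apply: cvgB; [exact: cvg_cst | apply: cvgZl; exact: cvg_id].
have /nbhs_ballP[e /= e0 eT] := lim _ Ty.
have /eT/Th : ball (0 : R) e (e / 2).
  by rewrite /ball/= sub0r normrN gtr0_norm ?divr_gt0 // gtr_pMr // invf_lt1 // ltr1n.
rewrite dotBr dotZr subr_ge0; apply: lt_le_trans.
by rewrite mulr_gt0 ?dot_sqr_gt0 ?divr_gt0.
Qed.

Lemma closure_hcone (T : set 'cV[R]_k) L y :
  (forall x, T x -> hcone L x) -> closure T y -> hcone L y.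
Proof.
move=> TL Ty h hL; rewrite leNgt; apply/negP => hy.
have : \forall x \near y, forall g, g \in [:: - h] -> 0 < dot g x.
  by apply: near_dot_gt0 => g; rewrite inE => /eqP->; rewrite dotNl oppr_gt0.
move=> /Ty[x [Tx /(_ (- h))]]; rewrite inE eqxx dotNl oppr_gt0 => /(_ isT).
by apply/negP; rewrite -leNgt; exact: TL.
Qed.

Lemma bounded_set_ray (X : set 'cV[R]_k) x d : bounded_set X ->
  (forall t : R, 0 <= t -> X (x + t *: d)) -> d = 0.
Proof.
move=> [M [_ /(_ (M + 1))]]; rewrite ltrDl ltr01 => /(_ isT) /= XM Xd.
apply/eqP/contraT; rewrite -normr_gt0 => d0.
have x0 : `|x| <= M + 1 by apply: XM; rewrite -[x]addr0 -(scale0r d); exact: Xd.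
(* Then [t *: d] has norm [2 * (M + 1) + 1], more than the norms of [x] and [x + t *: d] could add
   up to. *)
pose t := (2 * (M + 1) + 1) / `|d|.
have t0 : 0 <= t.
  by rewrite divr_ge0 // addr_ge0 // mulr_ge0 // (le_trans _ x0).
have := XM _ (Xd t t0); rewrite leNgt => /negP; case.
have : `|t *: d| <= `|x + t *: d| + `|x|.
  rewrite -{1}[t *: d](addKr x) addrC [leRHS]addrC.
  by rewrite (le_trans (ler_normD _ _)) // normrN addrC.
rewrite normrZ (ger0_norm t0) divfK ?gt_eqF //; lra.
Qed.

End Topology.

(** * Projective hulls and irredundant vertex lists *)

Section Hulls.
Variables (R : realType) (p : nat).
Implicit Types (x y v h : 'cV[R]_(p + 1)) (V G L : seq 'cV[R]_(p + 1)).

Lemma phull_min (P V : set 'cV[R]_(p + 1)) :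
  (forall x y, P x -> P y -> P (x + y)) ->
  (forall (a : R) x, 0 < a -> P x -> P (a *: x)) ->
  V `<=` P -> phull V `<=` P.
Proof.
move=> PD PZ VP _ [k [a [v [Vv a0 [i0 ai0] ->]]]].
(* [P] need not contain [0], so the induction over the sum keeps the case where all coefficients so
   far vanish. *)
suff [r0|//] : (forall i, i \in index_enum 'I_k -> a i = 0) \/
    P (\sum_(i <- index_enum 'I_k) a i *: v i).
  by move: ai0; rewrite r0 ?mem_index_enum ?eqxx.
elim: (index_enum 'I_k) => [|i r IH]; first by left.
rewrite big_cons; have [ai|ai] := eqVneq (a i) 0.
  rewrite ai scale0r add0r; case: IH => [r0|]; [left => j|by right].
  by rewrite inE => /orP[/eqP->|/r0].
have Pi : P (a i *: v i).
  by apply: PZ; [rewrite lt_neqAle eq_sym ai a0 | exact/VP/Vv].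
right; case: IH => [r0|/(PD _ _ Pi)//].
by rewrite big_seq big1 ?addr0 // => j /r0 ->; rewrite scale0r.
Qed.

Lemma phull_mono (V W : set 'cV[R]_(p + 1)) : V `<=` W -> phull V `<=` phull W.
Proof.
move=> VW _ [k [a [v [Vv a0 ai ->]]]]; exists k, a, v; split=> // i.
exact/VW/Vv.
Qed.

(** A common open half-space keeps nontrivial nonnegative combinations from vanishing. *)
Lemma phull_seq V h x : (forall v, v \in V -> 0 < dot h v) ->
  phull [set` V] x <-> incone V x /\ x != 0.
Proof.
move=> Vh; have [V0 VD VZ] := incone_cone V; split.
  suff sub : phull [set` V] `<=` [set y | incone V y /\ 0 < dot h y].
    by move=> /sub[Vx hx]; split=> //; apply: contraTneq hx => ->; rewrite dot0r ltxx.
  apply: phull_min => [y z [Vy hy] [Vz hz]|a y a0 [Vy hy]|v vV] /=.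
  - by rewrite dotDr addr_gt0 //; split=> //; exact: VD.
  - by rewrite dotZr mulr_gt0 //; split=> //; apply: VZ => //; exact: ltW.
  - by split; [exact: mem_incone | exact: Vh].
move=> [/incone_sum[a a0 xa] x0]; exists (size V), a, (fun i : 'I_(size V) => V`_i).
split=> // [i|]; first by rewrite /= mem_nth.
apply: contrapT => /forallNP na; move/eqP: x0; apply; rewrite xa big1 // => i _.
by have /negP := na i; rewrite negbK => /eqP->; rewrite scale0r.
Qed.

Lemma incone_phull_inj h V G : (forall v, v \in V -> 0 < dot h v) ->
  (forall g, g \in G -> 0 < dot h g) -> phull [set` V] = phull [set` G] ->
  incone V = incone G.
Proof.
move=> Vh Gh VG; apply/seteqP; split=> x Vx.
  have [->|x0] := eqVneq x 0; first by case: (incone_cone G).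
  have : phull [set` V] x by apply/(phull_seq _ Vh).
  by rewrite VG => /(phull_seq _ Gh)[].
have [->|x0] := eqVneq x 0; first by case: (incone_cone V).
have : phull [set` G] x by apply/(phull_seq _ Gh).
by rewrite -VG => /(phull_seq _ Vh)[].
Qed.

(** Removing a redundant point, with all its representatives, keeps the hull and shortens the list;
    hence the induction on length. *)
Lemma vertex_list_exists h G : h != 0 -> (forall g, g \in G -> 0 < dot h g) ->
  exists V, [/\ {subset V <= G}, is_vertex_list V & phull [set` V] = phull [set` G]].
Proof.
move=> h0; have [n] := ubnP (size G); elim: n G => // n IH G Gn Gh.
have [irr|] := pselect (forall v, v \in G ->
    phull [set w | w \in G /\ ~ same_point w v] <> phull [set` G]).
  by exists G; split=> //; split=> //; exists h.
move=> /existsNP[v /not_implyP[vG /contrapT GE]].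
pose G' := [seq w <- G | `[< ~ same_point w v >]].
have G'E : [set` G'] = [set w | w \in G /\ ~ same_point w v].
  apply/seteqP; split=> w /=; rewrite mem_filter.
    by case/andP=> /asboolP.
  by case=> wG /asboolP ->; rewrite wG.
have G'G : {subset G' <= G} by move=> w; rewrite mem_filter => /andP[].
have [|w /G'G /Gh//|V [VG' Vv VE]] := IH G'; last first.
  by exists V; split=> [w /VG'/G'G//|//|]; rewrite VE G'E.
rewrite -ltnS; apply: leq_trans Gn.
rewrite ltnS size_filter -(count_predC (fun w => `[< ~ same_point w v >]) G).
rewrite -[X in (X < _)%N]addn0 ltn_add2l -has_count; apply/hasP; exists v => //=.
by apply/negP => /asboolP; apply; exists 1; rewrite ?scale1r.
Qed.

Lemma represents_exists h G : h != 0 -> (forall g, g \in G -> 0 < dot h g) ->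
  exists s, represents s (phull [set` G]).
Proof.
move=> h0 Gh; have [V [_ Vv VE]] := vertex_list_exists h0 Gh.
have [L L0 GL] := weyl_neq0 G.
exists (State V L); split=> //=; apply/seteqP; split=> x.
  by case=> x0 Lx; apply/(phull_seq _ Gh); split=> //; apply/GL => g /Lx[].
by move=> /(phull_seq _ Gh)[/GL Lx x0]; split=> // g /Lx gx; split.
Qed.

(** Passing from vertices to normals, adding [h] and passing back generates the cut cone; the open
    half-space around the old vertices still contains its nonzero generators. *)
Lemma cut_exists (s : state R p) h : is_vertex_list (verts s) ->
  exists s', Defs.cut s h s'.
Proof.
move=> [[h1 h10 h1V] _]; have [L VL] := weyl_cone (verts s).
have [G LG] := minkowski_cone (h :: L).
have Gh1 g : g \in [seq g <- G | g != 0] -> 0 < dot h1 g.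
  rewrite mem_filter => /andP[g0 /mem_incone/LG Lg].
  by apply: incone_gt0 h1V _ g0; apply/VL => k kL; apply: Lg; rewrite inE kL orbT.
have [s' s'P] := represents_exists h10 Gh1; exists s'; rewrite /Defs.cut.
suff -> : polytope_of s `&` phalfspace h = phull [set` [seq g <- G | g != 0]] by [].
apply/seteqP; split=> x.
  case=> /(phull_seq _ h1V)[/VL Lx x0] [_ hx].
  apply/(phull_seq _ Gh1); split=> //; apply/incone_filter0/LG => k.
  by rewrite inE => /orP[/eqP->//|/Lx].
move=> /(phull_seq _ Gh1)[/incone_filter0/LG Lx x0]; split.
  apply/(phull_seq _ h1V); split=> //; apply/VL => k kL.
  by apply: Lx; rewrite inE kL orbT.
by split=> //; apply: Lx; rewrite inE eqxx.
Qed.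

(* If [v = y + z] nontrivially, then [v] is a combination of the other points,
   so [v] could be removed. *)
Lemma vertex_list_extreme V v : is_vertex_list V -> v \in V ->
  extreme_ray (incone V) v.
Proof.
move=> [[h h0 Vh] irr] vV; split; first exact: mem_incone.
  by apply: contraTneq (Vh v vV) => ->; rewrite dot0r ltxx.
pose V' := [seq w <- V | `[< ~ same_point w v >]].
have V'E : [set` V'] = [set w | w \in V /\ ~ same_point w v].
  apply/seteqP; split=> w /=; rewrite mem_filter.
    by case/andP=> /asboolP.
  by case=> wV /asboolP ->; rewrite wV.
have V'V g : g \in V' -> g \in V by rewrite mem_filter => /andP[].
have V'h g : g \in V' -> 0 < dot h g by move=> /V'V/Vh.
have [V'0 V'D V'Z] := incone_cone V'.
(* Separates the multiples of [v] in a combination of [V] from the part generated by the other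
   points. *)
have split_v y : incone V y ->
    exists a y', [/\ 0 <= a, incone V' y' & y = a *: v + y'].
  apply: (@incone_min _ _ [set y | exists a y', [/\ 0 <= a, incone V' y' &
    y = a *: v + y']]); first split=> /=.
  - by exists 0, 0; rewrite scale0r addr0.
  - move=> _ _ [a [y1 [a0 Vy1 ->]]] [b [y2 [b0 Vy2 ->]]].
    exists (a + b), (y1 + y2); rewrite addr_ge0 // scalerDl addrACA; split=> //.
    exact: V'D.
  - move=> c _ c0 [a [y1 [a0 Vy1 ->]]]; exists (c * a), (c *: y1).
    by rewrite mulr_ge0 // scalerDr scalerA; split=> //; exact: V'Z.
  - move=> g gV; have [[c c0 gc]|ng] := pselect (same_point g v).
      by exists c, 0; rewrite addr0 gc; split=> //; exact: ltW.
    exists 0, g; rewrite scale0r add0r; split=> //; apply: mem_incone.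
    by rewrite mem_filter gV andbT; apply/asboolP.
move=> y z /split_v[a [y' [a0 Vy' yE]]] /split_v[b [z' [b0 Vz' zE]]] vE.
have V'h_ge0 w : incone V' w -> 0 <= dot h w.
  by have [->|w0 /(incone_gt0 V'h)/(_ w0)/ltW//] := eqVneq w 0; rewrite dot0r.
have hvE : (1 - a - b) *: v = y' + z'.
  have := vE; rewrite yE zE addrACA -scalerDl => vE'.
  by rewrite -addrA -opprD scalerBl scale1r {1}vE' addrAC subrr add0r.
(* If this coefficient is nonpositive, pairing with [h] forces [y' = 0], so [y] is a multiple of
   [v]. Otherwise dividing by it puts [v] in the cone of [V'], against irredundancy. *)
have [le0|gt0] := leP (1 - a - b) 0.
  exists a => //; suff y'0 : y' = 0 by rewrite yE y'0 addr0.
  apply/eqP/contraT => /(incone_gt0 V'h Vy') hy'.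
  have : dot h ((1 - a - b) *: v) <= 0.
    by rewrite dotZr mulr_le0_ge0 // ltW // Vh.
  by rewrite hvE dotDr leNgt ltr_wpDr // V'h_ge0.
case: (irr v vV); rewrite -V'E; apply/seteqP; split.
  by apply: phull_mono => w /= /V'V.
move=> x /(phull_seq _ Vh)[Vx x0]; apply/(phull_seq _ V'h); split=> //.
have [c [x' [c0 Vx' ->]]] := split_v _ Vx; apply: (V'D) => //; apply: (V'Z) => //.
have -> : v = (1 - a - b)^-1 *: (y' + z').
  by rewrite -hvE scalerA mulVf ?scale1r // gt_eqF.
by apply: V'Z; [rewrite invr_ge0 ltW | exact: V'D].
Qed.

End Hulls.

(** * Boundary and crossing points *)

Section Crossing.
Variables (R : realType) (p : nat).
Implicit Types (x y v h ybar : 'cV[R]_(p + 1)) (G L : seq 'cV[R]_(p + 1)).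
Variables (T : set 'cV[R]_(p + 1)) (L : seq 'cV[R]_(p + 1)).
Variable h1 : 'cV[R]_(p + 1).
Hypothesis L0 : forall h, h \in L -> h != 0.
Hypothesis TL : forall x, T x <-> x != 0 /\ hcone L x.
Hypothesis Th1 : forall x, T x -> 0 < dot h1 x.

Lemma interiorP x : interior T x <-> T x /\ forall h, h \in L -> 0 < dot h x.
Proof.
split=> [Tx|[Tx Lx]].
  split=> [|h hL]; first exact: interior_subset.
  by apply: interior_dot_gt0 Tx; [exact: L0 | move=> y /TL[_]; apply].
(* Adding [h1] to the list keeps the neighbours of [x] nonzero. *)
have : \forall y \near x, forall h, h \in h1 :: L -> 0 < dot h y.
  apply: near_dot_gt0 => h; rewrite inE => /orP[/eqP->|/Lx//].
  exact: Th1.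
rewrite /interior/=; apply: filterS => y Ly; apply/TL; split=> [|h hL].
  by apply: contraTneq (Ly _ (mem_head _ _)) => ->; rewrite dot0r ltxx.
by apply/ltW/Ly; rewrite inE hL orbT.
Qed.

(** [T] is closed among nonzero vectors, and by [interiorP] a point of [T] fails to be interior
    exactly when some normal vanishes at it. *)
Lemma pboundaryP x :
  pboundary T x <-> T x /\ exists2 h, h \in L & dot h x = 0.
Proof.
split=> [[x0 [clTx ntTx]]|[Tx [h hL hx]]].
  have Tx : T x.
    by apply/TL; split=> //; apply: closure_hcone clTx => y /TL[].
  split=> //; apply: contrapT => nex; apply: ntTx; apply/interiorP; split=> // h hL.
  have /TL[_ Lx] := Tx; rewrite lt_neqAle Lx // andbT eq_sym.
  by apply/eqP => hx; apply: nex; exists h.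
split; first by case/TL: Tx.
split; first exact: subset_closure.
by move=> /interiorP[_ /(_ h hL)]; rewrite hx ltxx.
Qed.

Lemma boundary_supporting x : pboundary T x -> exists h, supporting T x h.
Proof.
move=> /pboundaryP[Tx [h hL hx]]; exists h; split=> //; first exact: L0.
by move=> y /TL[y0 Ly]; split=> //; exact: Ly.
Qed.

(* Up to scaling the segment consists of the points [v + t *: ybar], and
   [v + t *: ybar] lies in [T] exactly when [t] is at least the largest
   of the ratios [- dot h v / dot h ybar]. *)
Lemma crossing_exists_unique ybar v : interior T ybar -> 0 < dot h1 v -> ~ T v ->
  exists2 x, crossing T ybar v x &
    forall x', crossing T ybar v x' -> same_point x' x.
Proof.
move=> /interiorP[Ty Ly] h1v nTv.
have v0 : v != 0 by apply: contraTneq h1v => ->; rewrite dot0r ltxx.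
have [h hL hv] : exists2 h, h \in L & dot h v < 0.
  apply: contrapT => nex; apply: nTv; apply/TL; split=> // h hL.
  by rewrite leNgt; apply/negP => hv; apply: nex; exists h.
have L_neq0 : L != [::] by case: (L) hL.
have [g gL gmax] := seq_argmax (fun h => - dot h v / dot h ybar) L_neq0.
set t := - dot g v / dot g ybar in gmax.
have gE s : dot g (v + s *: ybar) = (s - t) * dot g ybar.
  by rewrite dotDr dotZr mulrBl /t divfK ?gt_eqF ?Ly // opprK addrC.
have Lge0 k : k \in L -> 0 <= dot k (v + t *: ybar).
  move=> kL; rewrite dotDr dotZr -lerBlDl sub0r -ler_pdivrMr ?Ly //.
  exact: gmax.
have t0 : 0 < t.
  by apply: lt_le_trans (gmax h hL); rewrite divr_gt0 ?oppr_gt0 ?Ly.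
have h1x : 0 < dot h1 (v + t *: ybar).
  by rewrite dotDr dotZr addr_gt0 // mulr_gt0 // Th1.
have Tx : T (v + t *: ybar).
  apply/TL; split; last exact: Lge0.
  by apply: contraTneq h1x => ->; rewrite dot0r ltxx.
exists (v + t *: ybar).
  split; first by exists 1, t; rewrite scale1r ler01 ltW // oner_eq0.
  by apply/pboundaryP; split=> //; exists g => //; rewrite gE subrr mul0r.
move=> x' [[a [b [a0 b0 ab xE]]]] /pboundaryP[Tx' [k kL kx']].
(* With [a = 0] the point would be a positive multiple of [ybar], where no normal vanishes. *)
have a_gt0 : 0 < a.
  rewrite lt_neqAle a0 andbT eq_sym; apply/eqP => aE.
  move: ab kx'; rewrite aE eqxx /= xE aE scale0r add0r dotZr => bN0 /eqP.
  by rewrite mulf_eq0 (negPf bN0) gt_eqF // Ly.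
have x'E : x' = a *: (v + (b / a) *: ybar).
  by rewrite scalerDr scalerA mulrCA divff ?gt_eqF // mulr1.
exists a => //; rewrite x'E; congr (_ *: (v + _ *: _)).
(* Membership of [x'] in [T], tested on [g], gives [t <= b / a]; the normal [k] vanishing at [x']
   gives the converse. *)
apply/eqP; rewrite eq_le; apply/andP; split; last first.
  have /TL[_ /(_ g gL)] := Tx'; rewrite x'E dotZr gE.
  by rewrite pmulr_rge0 // pmulr_lge0 ?Ly // subr_ge0.
move/eqP: kx'; rewrite x'E dotZr mulf_eq0 gt_eqF //= dotDr dotZr => /eqP kx'.
have := Lge0 k kL; rewrite dotDr dotZr -{1}kx' lerD2l.
by rewrite ler_pM2r ?Ly.
Qed.

End Crossing.

(** A vanishing sum of nonnegative terms vanishes termwise, so [h] is zero on each generator in the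
    support of [a], and the second combination involves no others. *)
Lemma supporting_support (R : realType) (p n : nat) (g : 'I_n -> 'cV[R]_(p + 1))
    (a b : 'I_n -> R) (h : 'cV[R]_(p + 1)) :
  (forall i, 0 <= dot h (g i)) -> (forall i, 0 <= a i) ->
  dot h (\sum_i a i *: g i) = 0 -> [set i | a i != 0]%SET = [set i | b i != 0]%SET ->
  dot h (\sum_i b i *: g i) = 0.
Proof.
have dot_sum (c : 'I_n -> R) :
    dot h (\sum_i c i *: g i) = \sum_i c i * dot h (g i).
  elim/big_rec2: _ => [|i x y _ <-]; first by rewrite dot0r.
  by rewrite dotDr dotZr.
move=> hg a0; rewrite !dot_sum => ha /setP ab.
have ge0 i : true -> 0 <= a i * dot h (g i) by rewrite mulr_ge0.
rewrite big1 // => i _; have /eqP := @psumr_eq0P _ _ _ _ ge0 ha i isT.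
rewrite mulf_eq0; have := ab i; rewrite !inE; case: eqP => //= _.
  by move=> /esym/negbFE/eqP->; rewrite mul0r.
by move=> _ /eqP->; rewrite mulr0.
Qed.

(** * Homogeneous coordinates and the outcome polytope *)

Section Coordinates.
Variables (R : realType) (p : nat).
Implicit Types (x h : 'cV[R]_(p + 1)) (y u : 'cV[R]_p) (i : 'I_p).

Lemma last_coordD x x' : last_coord (x + x') = last_coord x + last_coord x'.
Proof. by rewrite /last_coord mxE. Qed.

Lemma last_coordZ (a : R) x : last_coord (a *: x) = a * last_coord x.
Proof. by rewrite /last_coord mxE. Qed.

Lemma last_coord_col y (a : 'cV[R]_1) : last_coord (col_mx y a) = a 0 0.
Proof. by rewrite /last_coord col_mxEd. Qed.

Lemma last_homog y : last_coord (homog y) = 1.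
Proof. by rewrite last_coord_col mxE eqxx. Qed.

Lemma last_neg_infty i : last_coord (neg_infty R i) = 0.
Proof. by rewrite last_coord_col mxE. Qed.

Lemma homog_neq0 y : homog y != 0.
Proof.
apply/eqP => /(congr1 (@last_coord R p)); rewrite last_homog /last_coord mxE.
by apply/eqP; exact: oner_neq0.
Qed.

Lemma homog_inj : injective (@homog R p).
Proof. by move=> y u /(congr1 usubmx); rewrite !col_mxKu. Qed.

Lemma pcoordP x x' : last_coord x = last_coord x' -> usubmx x = usubmx x' -> x = x'.
Proof.
move=> lx ux; rewrite -[x]vsubmxK -[x']vsubmxK ux; congr col_mx.
by apply/colP => i; rewrite ord1 !mxE.
Qed.

Lemma homog_usubmx x : last_coord x = 1 -> x = homog (usubmx x).
Proof. by move=> lx; apply: pcoordP; rewrite ?last_homog // col_mxKu. Qed.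

Lemma scale_homog_dehomog x : visible x -> x = last_coord x *: homog (dehomog x).
Proof.
move=> vx; apply: pcoordP; first by rewrite last_coordZ last_homog mulr1.
by rewrite linearZ /= col_mxKu scalerA divff ?scale1r // gt_eqF.
Qed.

Lemma homog_dehomog x : visible x -> homog (dehomog x) = (last_coord x)^-1 *: x.
Proof.
move=> vx; rewrite {3}(scale_homog_dehomog vx) scalerA mulVf ?scale1r //.
by rewrite gt_eqF.
Qed.

Lemma dehomogK (c : R) y : c != 0 -> dehomog (c *: homog y) = y.
Proof.
move=> c0; rewrite /dehomog last_coordZ last_homog mulr1 linearZ /= col_mxKu.
by rewrite scalerA mulVf ?scale1r.
Qed.

Lemma homog_comb (s t : R) y u : s + t = 1 ->
  s *: homog y + t *: homog u = homog (s *: y + t *: u).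
Proof.
move=> st; rewrite /homog !scale_col_mx add_col_mx; congr col_mx.
by rewrite -scalerDl st scale1r.
Qed.

Lemma dot_col h x : dot h x = dot (usubmx h) (usubmx x) + last_coord h * last_coord x.
Proof.
rewrite /dot big_split_ord /= big_ord1; congr (_ + _).
by apply: eq_bigr => i _; rewrite !mxE.
Qed.

Lemma dot_homog h y : dot h (homog y) = dot (usubmx h) y + last_coord h.
Proof. by rewrite dot_col last_homog mulr1 col_mxKu. Qed.

Lemma dot_neg_infty h i : dot h (neg_infty R i) = - usubmx h i 0.
Proof.
rewrite dot_col last_neg_infty mulr0 addr0 col_mxKu dotC dotNl.
by rewrite dot_delta.
Qed.

Definition neg_infties : seq 'cV[R]_(p + 1) :=
  [seq neg_infty R i | i <- enum 'I_p].

Lemma mem_neg_infties x : (x \in neg_infties) <-> range (@neg_infty R p) x.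
Proof.
split=> [/mapP[i _ ->]|[i _ <-]]; first by exists i.
by apply/mapP; exists i; rewrite ?mem_enum.
Qed.

Lemma incone_neg_infties x :
  incone neg_infties x <-> last_coord x = 0 /\ forall i, usubmx x i 0 <= 0.
Proof.
split.
  apply: (@incone_min _ _ [set x | last_coord x = 0 /\ forall i, usubmx x i 0 <= 0]).
    split=> /= [|u v [u0 ui] [v0 vi]|a u a0 [u0 ui]].
    - by split=> [|i]; rewrite /last_coord ?mxE.
    - rewrite last_coordD u0 v0 addr0; split=> // i.
      by have := ui i; have := vi i; rewrite !mxE; lra.
    - rewrite last_coordZ u0 mulr0; split=> // i.
      by have := ui i; rewrite !mxE => ?; rewrite mulr_ge0_le0.
  move=> _ /mapP[i _ ->]; rewrite /= last_neg_infty; split=> // j.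
  by rewrite col_mxKu !mxE oppr_le0 ler0n.
case=> x0 xi; have [G0 GD GZ] := incone_cone neg_infties.
have -> : x = \sum_i (- usubmx x i 0) *: neg_infty R i.
  apply: pcoordP.
    rewrite x0; elim/big_rec: _ => [|i z _ z0]; first by rewrite /last_coord mxE.
    by rewrite last_coordD last_coordZ last_neg_infty mulr0 add0r.
  rewrite linear_sum; apply/colP => j; rewrite summxE (bigD1 j) //= big1 => [|i ij].
    by rewrite linearZ /= col_mxKu !mxE !eqxx mulrN1 opprK addr0.
  by rewrite linearZ /= col_mxKu !mxE eq_sym (negPf ij) oppr0 mulr0.
elim/big_rec: _ => [//|i z _ Gz]; apply: (GD) => //; apply: (GZ).
  by rewrite oppr_ge0.
by apply: mem_incone; apply/mem_neg_infties; exists i.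
Qed.

(** Turns the componentwise order into membership in the cone at infinity. *)
Lemma homog_le_incone y y' : vle y y' -> incone neg_infties (homog y - homog y').
Proof.
move=> yy'; apply/incone_neg_infties; split.
  by rewrite -scaleN1r last_coordD last_coordZ !last_homog mulN1r subrr.
by move=> i; rewrite linearB /= !col_mxKu !mxE subr_le0.
Qed.

End Coordinates.

Lemma incone_map (R : realType) (k k' : nat) (B : 'M[R]_(k', k))
    (G : seq 'cV[R]_k) (z : 'cV[R]_k') :
  incone [seq B *m g | g <- G] z <-> exists2 x, incone G x & z = B *m x.
Proof.
elim: G z => [|g G IH] z /=; first by split=> [->|[x -> ->]];
  [exists 0|]; rewrite ?mulmx0.
split=> [[t t0 /IH[x Gx zE]]|[x [t t0 Gx] ->]].
  exists (x + t *: g); first by exists t; rewrite ?addrK.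
  by rewrite mulmxDr -scalemxAr -zE subrK.
exists t => //; apply/IH; exists (x - t *: g) => //.
by rewrite mulmxBr -scalemxAr.
Qed.

(** * The homogenised outcome set *)

Section Outcomes.
Variables (R : realType) (m n p : nat).
Variables (A : 'M[R]_(m, n)) (b : 'cV[R]_m) (C : 'M[R]_(p, n)).

(** Homogenises the equality constraints to [A *m x = s *: b], with [s] the last coordinate. *)
Let D := row_mx A (- b).

Lemma feasible_hcone : exists L, forall x : 'cV[R]_(n + 1),
  hcone L x <-> D *m x = 0 /\ vle 0 x.
Proof.
have dot_row i x : dot (row i D)^T x = (D *m x) i 0.
  by rewrite /dot mxE; apply: eq_bigr => j _; rewrite !mxE.
exists ([seq (row i D)^T | i <- enum 'I_m] ++
  [seq - (row i D)^T | i <- enum 'I_m] ++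
  [seq delta_mx i 0 | i <- enum 'I_(n + 1)]) => x; split=> [Lx|[Dx x0] h].
  split=> [|i].
    apply/colP => i; apply/eqP; rewrite [eqbRHS]mxE eq_le -oppr_ge0 -!dot_row -dotNl.
    apply/andP; split; apply: Lx; rewrite !mem_cat; apply/or3P.
      by apply: Or32; apply/mapP; exists i; rewrite ?mem_enum.
    by apply: Or31; apply/mapP; exists i; rewrite ?mem_enum.
  rewrite mxE -dot_delta; apply: Lx; rewrite !mem_cat; apply/or3P.
  by apply: Or33; apply/mapP; exists i; rewrite ?mem_enum.
rewrite !mem_cat => /or3P[] /mapP[i _ ->].
- by rewrite dot_row Dx mxE.
- by rewrite dotNl dot_row Dx mxE oppr0.
- by rewrite dot_delta; have := x0 i; rewrite mxE.
Qed.

Lemma mulD (x : 'cV[R]_(n + 1)) :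
  D *m x = A *m usubmx x - last_coord x *: b.
Proof.
rewrite -{1}[x]vsubmxK mul_row_col mulNmx; congr (_ - _).
apply/colP => i; rewrite !mxE big_ord1 mulrC; congr (_ * _).
by rewrite mxE.
Qed.

Lemma feasible_homog x : feasible A b x <-> D *m homog x = 0 /\ vle 0 (homog x).
Proof.
rewrite mulD last_homog scale1r col_mxKu; split=> [[-> x0]|[/eqP]].
  rewrite subrr; split=> // i; rewrite mxE; case: (split_ordP i) => j ->.
    by have := x0 j; rewrite mxE (col_mxEu x 1%:M j).
  by rewrite col_mxEd ord1 mxE eqxx ler01.
rewrite subr_eq0 => /eqP Ax x0; split=> // i.
by have := x0 (lshift 1 i); rewrite mxE (col_mxEu x 1%:M i) mxE.
Qed.

(** Minkowski's theorem gives generators of the homogenised feasible cone, which are then mapped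
    through [C]. A nonzero generator at infinity would be a recession direction of the bounded
    feasible set. *)
Lemma outcomes_generated : feasible A b !=set0 -> bounded_set (feasible A b) ->
  exists2 W : seq 'cV[R]_(p + 1), forall w, w \in W -> visible w &
    forall y, outcomes A b C y <-> incone W (homog y).
Proof.
move=> [x0 Xx0] bX; have [L LD] := feasible_hcone.
have [G LG] := minkowski_cone L.
have GD g : incone G g -> D *m g = 0 /\ vle 0 g by move=> /LG/LD.
pose G' := [seq g <- G | g != 0].
(* [C] acts on the Euclidean coordinates while the homogenising coordinate is kept. *)
pose B : 'M[R]_(p + 1, n + 1) := block_mx C 0 0 1%:M.
have BE x : B *m x = col_mx (C *m usubmx x) (dsubmx x).
  by rewrite -{1}[x]vsubmxK mul_block_col !mul0mx mul1mx addr0 add0r.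
have lastB x : last_coord (B *m x) = last_coord x.
  by rewrite BE last_coord_col /last_coord mxE.
exists [seq B *m g | g <- G'] => [w /mapP[g]|y].
  rewrite mem_filter => /andP[g0 /mem_incone Gg] ->.
  rewrite /visible lastB; have [Dg gge0] := GD _ Gg.
  have : 0 <= last_coord g by have := gge0 (rshift n ord0); rewrite mxE.
  rewrite le_eqVlt.
  case/orP=> // /eqP lg; case/eqP: g0; apply: pcoordP.
    by rewrite -lg /last_coord mxE.
  rewrite [RHS]linear0; apply: (bounded_set_ray bX (x := x0)) => t t0.
  move: Dg; rewrite mulD -lg scale0r subr0 => Ag; case: Xx0 => Ax0 x0ge0.
  split=> [|i]; first by rewrite mulmxDr -scalemxAr Ag scaler0 addr0.
  have := x0ge0 i; have := gge0 (lshift 1 i); rewrite !mxE => g1 x1.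
  by rewrite addr_ge0 ?mulr_ge0.
rewrite incone_map; split=> [[x Xx <-]|[x /incone_filter0 Gx yE]].
  exists (homog x); first by apply/incone_filter0/LG/LD/feasible_homog.
  by rewrite BE col_mxKu col_mxKd.
have lx : last_coord x = 1 by rewrite -lastB -yE last_homog.
exists (usubmx x); first by apply/feasible_homog; rewrite -homog_usubmx //; exact: GD.
have := congr1 usubmx yE; rewrite BE !col_mxKu => -> //.
Qed.

End Outcomes.

(** * The algorithm *)

Lemma extreme_ray_scale (R : realType) (k : nat) (P : set 'cV[R]_k) (c : R) x :
  convex_cone P -> 0 < c -> extreme_ray P (c *: x) -> extreme_ray P x.
Proof.
move=> [P0 PD PZ] c0 [Px x0 ext]; split.
- rewrite -[x]scale1r -(mulVf (lt0r_neq0 c0)) -scalerA; apply: PZ => //.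
  by rewrite invr_ge0 ltW.
- by apply: contraNneq x0 => ->; rewrite scaler0.
move=> y z Py Pz xE; have [|||t t0] := ext (c *: y) (c *: z).
- by apply: PZ => //; exact: ltW.
- by apply: PZ => //; exact: ltW.
- by rewrite xE scalerDr.
- move=> cy; exists t => //; apply: (scalerI (lt0r_neq0 c0)).
  by rewrite cy scalerA mulrC scalerA.
Qed.

Lemma nat_finType_collision (T : finType) (f : nat -> T) :
  exists i j, (i < j)%N /\ f i = f j.
Proof.
have /injectivePn[i [j ij fij]] : ~~ injectiveb (fun i : 'I_#|T|.+1 => f i).
  by apply/negP => /injectiveP/leq_card; rewrite card_ord ltnn.
have : i != j :> nat by [].
by rewrite neq_ltn => /orP[ij'|ij']; [exists i, j | exists j, i].
Qed.

Section Algorithm.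
Variables (R : realType) (p : nat) (Y : set 'cV[R]_p).
Variable W : seq 'cV[R]_(p + 1).
Hypothesis W_visible : forall w, w \in W -> visible w.
Hypothesis YW : forall y, Y y <-> incone W (homog y).
Hypothesis Y_neq0 : Y !=set0.

(** Generators of the cone over [T^<=]; those from [W] need not be vertices. *)
Let gens := W ++ neg_infties R p.

(** Lowering an outcome adds points at infinity. Conversely these contribute nothing to the last
    coordinate, so the part generated by [W] is itself an outcome, lying above [y]. *)
Lemma down_closureP y : down_closure Y y <-> incone gens (homog y).
Proof.
have [_ GD _] := incone_cone gens.
split=> [[y' /YW Wy' yy']|/incone_cat[w [z [Ww /incone_neg_infties[z0 zi] yE]]]].
  have -> : homog y = homog y' + (homog y - homog y') by rewrite addrC subrK.
  apply: GD.
    by apply: incone_sub Wy' => w wW; apply: mem_incone; rewrite mem_cat wW.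
  apply: incone_sub (homog_le_incone yy') => w wW.
  by apply: mem_incone; rewrite mem_cat wW orbT.
have lw : last_coord w = 1.
  by rewrite -(last_homog y) yE last_coordD z0 addr0.
exists (usubmx w); first by apply/YW; rewrite -homog_usubmx.
move=> i; have := zi i; have /(congr1 usubmx) := yE.
rewrite linearD /= col_mxKu => -> /=; rewrite !mxE; lra.
Qed.

Lemma visible_gen_outcome w : w \in W -> Y (dehomog w).
Proof.
move=> wW; apply/YW; have [_ _ GZ] := incone_cone W.
have vw := W_visible wW; rewrite homog_dehomog //.
by apply: GZ; [rewrite invr_ge0 ltW | exact: mem_incone].
Qed.

Lemma outcomes_convex (x y : 'cV[R]_p) (t : R) : 0 <= t <= 1 -> Y x -> Y y ->
  Y (t *: x + (1 - t) *: y).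
Proof.
move=> /andP[t0 t1] /YW Wx /YW Wy; apply/YW.
have [_ GD GZ] := incone_cone W.
rewrite -homog_comb ?subrKC //; apply: GD; apply: GZ => //.
by rewrite subr_ge0.
Qed.

(** For an efficient extreme outcome, the ends of a segment through [v] are replaced by outcomes
    above them: efficiency keeps the combination at [v], and extremality moves both outcomes to [v].
    Conversely a vertex of the down closure equals every outcome above it. *)
Lemma efficient_extremeP v :
  efficient_extreme Y v <-> vertex (down_closure Y) v.
Proof.
have sub y : Y y -> down_closure Y y by exists y => // i.
split=> [[[Yv vtx] [_ eff]]|[[y Yy vy] vtx]].
  split=> [|x y t [x' Yx' xx'] [y' Yy' yy'] /andP[t0 t1] vE]; first exact: sub.
  have t1' : 0 < 1 - t by rewrite subr_gt0.
  have vE' : v = t *: x' + (1 - t) *: y'.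
    apply: contrapT => ne; apply: eff; exists (t *: x' + (1 - t) *: y'); split.
    - by apply: outcomes_convex => //; rewrite !ltW.
    - by move=> e; apply: ne.
    - by move=> i; rewrite vE !mxE lerD // ler_wpM2l // ?ltW.
  have [x'v y'v] : x' = v /\ y' = v by apply: (vtx _ _ t) => //; rewrite t0.
  have vi i : v i 0 = t * x i 0 + (1 - t) * y i 0 by rewrite {1}vE !mxE.
  have xi i : x i 0 <= v i 0 by rewrite -x'v.
  have yi i : y i 0 <= v i 0 by rewrite -y'v.
  (* Both terms are nonnegative, so both vanish. *)
  have xv i : (1 - t) * (v i 0 - y i 0) + t * (v i 0 - x i 0) = 0.
    by have := vi i; lra.
  split; apply/colP => i; apply/eqP; rewrite eq_le.
    rewrite xi /= -subr_le0 -(pmulr_rle0 _ t0); have := xv i.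
    by have : 0 <= (1 - t) * (v i 0 - y i 0); [rewrite mulr_ge0 ?subr_ge0 // ltW | lra].
  rewrite yi /= -subr_le0 -(pmulr_rle0 _ t1'); have := xv i.
  by have : 0 <= t * (v i 0 - x i 0); [rewrite mulr_ge0 ?subr_ge0 // ltW | lra].
have above y' : Y y' -> vle v y' -> y' = v.
  move=> Yy' vy'.
  (* [v] is the midpoint of [y'] and its reflection [2 *: v - y'], which lies below [y']. *)
  have [] // := vtx y' (2 *: v - y') (1 / 2); [exact: sub| | |].
  - by exists y' => // i; have := vy' i; rewrite !mxE; lra.
  - by apply/andP; split; lra.
  - by apply/colP => i; rewrite !mxE; field.
have Yv : Y v by rewrite -(above y Yy vy).
split; split=> //; first by move=> a b t Ya Yb; apply: vtx; exact: sub.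
by move=> [y' [Yy' y'v vy']]; exact/y'v/above.
Qed.

(** Each maximum is attained at a dehomogenised generator: in homogeneous form the bound is linear
    and passes from [W] to its cone. *)
Lemma ideal_point_exists : exists ymax, is_ideal_point Y ymax.
Proof.
have [y0 /YW Wy0] := Y_neq0.
have W_neq0 : W != [::].
  by apply/eqP => W0; move: Wy0; rewrite W0 /= => /eqP; rewrite (negPf (homog_neq0 _)).
have maxi i : exists a, (exists2 y, Y y & y i 0 = a) /\ forall y, Y y -> y i 0 <= a.
  have [w wW wmax] := seq_argmax (fun w => dehomog w i 0) W_neq0.
  exists (dehomog w i 0); split.
    by exists (dehomog w) => //; exact: visible_gen_outcome.
  set a := dehomog w i 0 in wmax *.
  have : forall x, incone W x -> usubmx x i 0 <= a * last_coord x.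
    move=> x; apply: (@incone_min _ _ [set x | usubmx x i 0 <= a * last_coord x]).
      split=> /= [|u v ua va|c u c0 ua].
      - by rewrite /last_coord !mxE mulr0.
      - by rewrite last_coordD mulrDr linearD [X in X <= _]mxE lerD.
      - by rewrite last_coordZ linearZ [X in X <= _]mxE mulrCA ler_wpM2l.
    move=> g gW /=; have vg := W_visible gW.
    rewrite {1}(scale_homog_dehomog vg) linearZ /= col_mxKu mxE mulrC.
    by apply: ler_wpM2r; [exact: ltW | exact: wmax].
  by move=> W_le y /YW/W_le; rewrite last_homog mulr1 col_mxKu.
have [f fP] := choice maxi; exists (\col_i f i) => i.
by rewrite mxE; have [[y Yy yi] fmax] := fP i; split=> //; exists y.
Qed.

(** * The ideal point and the initial simplex *)

Section Ideal.
Variable ymax : 'cV[R]_p.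
Hypothesis ymaxP : is_ideal_point Y ymax.

Let simplex := homog ymax :: neg_infties R p.

(* A normal whose half-space contains [Q_0], and hence every [Q_i], in its
   interior. *)
Let pole : 'cV[R]_(p + 1) :=
  col_mx (const_mx (-1)) (const_mx (1 + `|\sum_i ymax i 0|)).

Lemma pole_neq0 : pole != 0.
Proof.
apply/eqP => /(congr1 (@last_coord R p)); rewrite last_coord_col /last_coord !mxE.
by apply/eqP; rewrite gt_eqF // ltr_pwDl.
Qed.

(** The last entry of [pole] exceeds the sum of the coordinates of [ymax], and its entries [-1] pair
    to [1] with the points at infinity. *)
Lemma pole_simplex g : g \in simplex -> 0 < dot pole g.
Proof.
rewrite inE => /orP[/eqP->|/mapP[i _ ->]].
  rewrite dot_homog last_coord_col col_mxKu mxE /dot.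
  under eq_bigr do rewrite mxE mulN1r.
  by rewrite sumrN addrCA ltr_pwDl // addrC subr_ge0 ler_norm.
by rewrite dot_neg_infty col_mxKu mxE opprK ltr01.
Qed.

(** Every outcome lies below [ymax], hence is [homog ymax] plus points at infinity. This gives the
    inclusion of [T^<=] in [Q_0]. *)
Lemma gens_simplex x : incone gens x -> incone simplex x.
Proof.
have [_ GD GZ] := incone_cone simplex.
apply: incone_sub => g; rewrite mem_cat => /orP[gW|gN]; last first.
  by apply: mem_incone; rewrite inE gN orbT.
rewrite (scale_homog_dehomog (W_visible gW)); apply: (GZ); first exact/ltW/W_visible.
set y := dehomog g.
have -> : homog y = homog ymax + (homog y - homog ymax) by rewrite addrC subrK.
apply: (GD); first by apply: mem_incone; rewrite mem_head.
have yymax : vle y ymax by move=> i; apply: (ymaxP i).2; exact: visible_gen_outcome.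
apply: incone_sub (homog_le_incone yymax) => w wW.
by apply: mem_incone; rewrite inE wW orbT.
Qed.

(** The last coordinate is the coefficient of [homog ymax]; once it vanishes only points at infinity
    remain. *)
Lemma simplex_last x : incone simplex x ->
  0 <= last_coord x /\ (last_coord x = 0 -> incone (neg_infties R p) x).
Proof.
case=> t t0 Nx; have := Nx => /incone_neg_infties[].
rewrite -scaleN1r scalerA last_coordD last_coordZ last_homog mulr1 mulN1r.
move=> /eqP; rewrite subr_eq0 => /eqP lx _; rewrite lx; split=> // tE.
by move: Nx; rewrite tE scale0r subr0.
Qed.

Lemma pole_gens g : g \in gens -> 0 < dot pole g.
Proof.
move=> gG; apply: (incone_gt0 pole_simplex); first exact/gens_simplex/mem_incone.
move: gG; rewrite mem_cat => /orP[/W_visible|/mapP[i _ ->]].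
  by apply: contraTneq => ->; rewrite /visible /last_coord mxE ltxx.
apply/eqP => /(congr1 usubmx)/colP/(_ i); rewrite col_mxKu !mxE !eqxx.
by apply/eqP; rewrite oppr_eq0 oner_neq0.
Qed.

Lemma simplexE : homog ymax |` range (@neg_infty R p) = [set` simplex].
Proof.
apply/seteqP; split=> x /=; rewrite inE.
  by case=> [->|/mem_neg_infties ->]; rewrite ?eqxx ?orbT.
by case/orP => [/eqP->|/mem_neg_infties]; [left | right].
Qed.

Lemma initial_exists : exists s, initial Y s.
Proof.
have [s sP] := represents_exists pole_neq0 pole_simplex.
by exists s, ymax; rewrite ?simplexE.
Qed.

End Ideal.

(** * Extreme rays and interior of the cone over [T^<=] *)

Lemma gens_pole : exists2 h, h != 0 & forall g, g \in gens -> 0 < dot h g.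
Proof.
have [ymax ymaxP] := ideal_point_exists.
by eexists; [exact: (pole_neq0 ymax) | exact: pole_gens].
Qed.

Lemma gens_last x : incone gens x ->
  0 <= last_coord x /\ (last_coord x = 0 -> incone (neg_infties R p) x).
Proof.
have [ymax ymaxP] := ideal_point_exists.
by move=> /(gens_simplex ymaxP)/simplex_last.
Qed.

Lemma neg_infties_gens x : incone (neg_infties R p) x -> incone gens x.
Proof.
apply: incone_sub => g gN.
by apply: mem_incone; rewrite mem_cat gN orbT.
Qed.

(** Two visible summands of [homog v] rescale to points of the down closure, with [v] their convex
    combination weighted by last coordinates. Conversely a convex combination homogenises to a sum,
    and last coordinates fix the multiples. *)
Lemma vertex_extreme v :
  vertex (down_closure Y) v <-> extreme_ray (incone gens) (homog v).
Proof.
have [_ GD GZ] := incone_cone gens.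
split=> [[/down_closureP Gv vtx]|[Gv v0 ext]].
  split=> // [|y z Gy Gz yz]; first exact: homog_neq0.
  have lyz : last_coord y + last_coord z = 1.
    by rewrite -last_coordD -yz last_homog.
  (* A summand at infinity with coordinates [d] makes [v] the midpoint of
     [v - d] and [v + d]. *)
  have infinite y' z' : incone gens y' -> incone gens z' ->
      homog v = y' + z' -> last_coord y' = 0 -> y' = 0.
    move=> Gy' Gz' yz' ly'; set d := usubmx y'.
    have vd (s : R) : homog v + s *: y' = homog (v + s *: d).
      rewrite [LHS]homog_usubmx; first by rewrite linearD linearZ /= col_mxKu.
      by rewrite last_coordD last_homog last_coordZ ly' mulr0 addr0.
    have [||||_] := vtx (v + (-1) *: d) (v + 1 *: d) (1 / 2).
    - apply/down_closureP; rewrite -vd scaleN1r yz' addrAC subrr add0r //.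
    - apply/down_closureP; rewrite -vd; apply: GD => //.
      by apply: GZ => //; rewrite ler01.
    - by apply/andP; split; lra.
    - by apply/colP => i; rewrite !mxE; field.
    move=> /eqP; rewrite scale1r -subr_eq0 addrAC subrr add0r => /eqP d0.
    by apply: pcoordP; rewrite ?ly' -/d ?d0 ?linear0 // /last_coord mxE.
  have [+ _] := gens_last Gy; rewrite le_eqVlt => /orP[/eqP ly|ly].
    by exists 0; rewrite // scale0r; apply: infinite yz _.
  have [+ _] := gens_last Gz; rewrite le_eqVlt => /orP[/eqP lz|lz].
    exists 1; rewrite // scale1r yz [X in _ = _ + X](infinite z y) ?addr0 //.
    by rewrite addrC.
  exists (last_coord y); first exact: ltW.
  have D x : incone gens x -> visible x -> down_closure Y (dehomog x).
    move=> Gx vx; apply/down_closureP; rewrite homog_dehomog //.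
    by apply: GZ => //; rewrite invr_ge0 ltW.
  have [||yv _] := vtx _ _ (last_coord y) (D y Gy ly) (D z Gz lz).
  - by rewrite ly -lyz ltrDl.
  - apply: homog_inj; rewrite -homog_comb ?subrKC //.
    by rewrite -lyz addrAC subrr add0r -!scale_homog_dehomog.
  - by rewrite -yv -scale_homog_dehomog.
have side x y t : down_closure Y x -> down_closure Y y -> 0 < t < 1 ->
    v = t *: x + (1 - t) *: y -> x = v.
  move=> /down_closureP Gx /down_closureP Gy /andP[t0 t1] vE.
  have [|||c c0 tx] := ext (t *: homog x) ((1 - t) *: homog y).
  - by apply: GZ => //; exact: ltW.
  - by apply: GZ => //; rewrite subr_ge0 ltW.
  - by rewrite homog_comb ?subrKC // -vE.
  move: tx => tx; have := congr1 (@last_coord R p) tx.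
  rewrite !last_coordZ !last_homog !mulr1 => tc.
  move: tx; rewrite -tc => tx; rewrite -(dehomogK x (lt0r_neq0 t0)) tx.
  by rewrite dehomogK // lt0r_neq0.
split=> [|x y t Dx Dy t01 vE]; first exact/down_closureP.
split; first exact: (side x y t).
apply: (side y x (1 - t)) => //; first by lra.
by rewrite subKr addrC.
Qed.

(** Links the hull of vertices to the explicit generators. The nontrivial inclusion thins [gens] to
    an irredundant list, whose visible members span extreme rays and so normalise to vertices of the
    down closure. *)
Lemma TleE : Tle Y = phull [set` gens].
Proof.
have [h h0 hG] := gens_pole; have [_ GD GZ] := incone_cone gens.
apply/seteqP; split=> x.
  suff sub : Tle Y `<=` [set y | incone gens y /\ 0 < dot h y].
    move=> /sub[Gx hx]; apply/(phull_seq _ hG); split=> //.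
    by apply: contraTneq hx => ->; rewrite dot0r ltxx.
  apply: phull_min => [y z [Gy hy] [Gz hz]|a y a0 [Gy hy]|v vV] /=.
  - by rewrite dotDr addr_gt0 //; split=> //; exact: GD.
  - by rewrite dotZr mulr_gt0 //; split=> //; apply: GZ => //; exact: ltW.
  suff Gv : incone gens v /\ v != 0.
    by case: Gv => Gv v0; split=> //; exact: incone_gt0 hG Gv v0.
  case: vV => [[u /vertex_extreme[Gu u0 _] <-]//|/mem_neg_infties vN].
  have vG : v \in gens by rewrite mem_cat vN orbT.
  split; first exact: mem_incone.
  by apply: contraTneq (hG v vG) => ->; rewrite dot0r ltxx.
have [V [VG Vv VE']] := vertex_list_exists h0 hG.
have hV v : v \in V -> 0 < dot h v by move=> /VG/hG.
rewrite -VE'.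
have VE : incone V = incone gens by exact: incone_phull_inj hV hG VE'.
pose V' := [seq homog (dehomog v) | v <- V & 0 < last_coord v] ++ neg_infties R p.
have hV' v : v \in V' -> 0 < dot h v.
  rewrite mem_cat => /orP[/mapP[u]|vN]; last by apply: hG; rewrite mem_cat vN orbT.
  rewrite mem_filter => /andP[u0 uV] ->.
  have := hV u uV; rewrite {1}(scale_homog_dehomog u0) dotZr.
  by rewrite pmulr_rgt0.
have V'_Tle : phull [set` V'] `<=` Tle Y.
  apply: phull_mono => v; rewrite /= mem_cat => /orP[/mapP[u]|/mem_neg_infties].
    rewrite mem_filter => /andP[u0 uV] ->; left; exists (dehomog u) => //.
    apply/vertex_extreme; apply: (@extreme_ray_scale _ _ _ (last_coord u)) => //.
      exact: incone_cone.
    rewrite -scale_homog_dehomog // -VE; exact: vertex_list_extreme.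
  by right.
move=> /(phull_seq _ hV)[Vx x0]; apply: V'_Tle; apply/(phull_seq _ hV'); split=> //.
have [_ _ GZ'] := incone_cone V'.
(* A member of [V] at infinity lies in the cone of the standard points at infinity; a visible one is
   a multiple of its normalisation in [V']. *)
apply: incone_sub Vx => v vV; have [+ lv0] := gens_last (mem_incone (VG v vV)).
rewrite le_eqVlt => /orP[/eqP/esym/lv0|lv].
  apply: incone_sub => g gN.
  by apply: mem_incone; rewrite mem_cat gN orbT.
rewrite (scale_homog_dehomog lv); apply: (GZ'); first exact: ltW.
apply: mem_incone; rewrite mem_cat; apply/orP; left.
by apply/mapP; exists v; rewrite ?mem_filter ?lv.
Qed.

Lemma TleP h x : (forall g, g \in gens -> 0 < dot h g) ->
  Tle Y x <-> incone gens x /\ x != 0.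
Proof. by move=> hG; rewrite TleE; exact: phull_seq hG. Qed.

Lemma Tle_hcone : exists2 L : seq 'cV[R]_(p + 1), forall h, h \in L -> h != 0 &
  forall x, Tle Y x <-> x != 0 /\ hcone L x.
Proof.
have [h h0 hG] := gens_pole; have [L L0 GL] := weyl_neq0 gens.
by exists L => // x; rewrite (TleP _ hG) GL; tauto.
Qed.

(* The point [y - 1] works: [homog (y - 1)] is the sum of [homog y] and of all
   the points at infinity, on which a nonzero normal cannot vanish throughout. *)
Lemma Tle_interior_nonempty : exists ybar, interior (Tle Y) ybar.
Proof.
have [h1 h10 h1G] := gens_pole; have [L L0 TL] := Tle_hcone.
have Th1 x : Tle Y x -> 0 < dot h1 x.
  by move=> /(TleP _ h1G)[Gx]; exact: incone_gt0 h1G Gx.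
have [y Yy] := Y_neq0; pose z := homog (y - const_mx 1).
have Gz : incone gens z.
  apply/down_closureP; exists y => // i; rewrite !mxE; lra.
exists z; apply/(interiorP L0 TL Th1); split.
  by apply/(TleP _ h1G); split=> //; exact: homog_neq0.
move=> h hL; have hG x : incone gens x -> 0 <= dot h x.
  have [->|x0 Gx] := eqVneq x 0; first by rewrite dot0r.
  by have /TL[_] : Tle Y x by [apply/(TleP _ h1G)]; apply.
have hy : 0 <= dot h (homog y) by apply/hG/down_closureP; exists y.
have hN i : 0 <= - usubmx h i 0.
  rewrite -dot_neg_infty; apply/hG/neg_infties_gens/mem_incone.
  by apply/mem_neg_infties; exists i.
have zE : dot h z = dot h (homog y) + \sum_i - usubmx h i 0.
  rewrite /z !dot_homog dotBr addrAC; congr (_ + _); rewrite -sumrN.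
  by apply: eq_bigr => i _; rewrite [const_mx _ _ _]mxE mulr1.
have sN : 0 <= \sum_i - usubmx h i 0 by apply: sumr_ge0 => i _.
rewrite zE lt_neqAle addr_ge0 // andbT eq_sym paddr_eq0 //.
apply/negP => /andP[/eqP hy0 /eqP hN0].
have uh0 : usubmx h = 0.
  apply/colP => i; have /eqP := @psumr_eq0P _ _ _ _ (fun i _ => hN i) hN0 i isT.
  by rewrite oppr_eq0 [RHS]mxE => /eqP.
move/eqP: (L0 h hL); apply; apply: pcoordP; last by rewrite uh0 linear0.
by rewrite -[LHS]add0r -(dot0r y) dotC -uh0 -dot_homog hy0 /last_coord mxE.
Qed.

(** * Runs: invariant, executability, termination and output *)

Section Run.
Variable ybar : 'cV[R]_(p + 1).
Hypothesis ybar_int : interior (Tle Y) ybar.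

(** The last clause holds for the simplex and is inherited because the polytopes shrink. It is why
    testing only visible vertices suffices. *)
Lemma reachable_invariant s : reachable Y ybar s ->
  [/\ is_vertex_list (verts s), Tle Y `<=` polytope_of s &
    forall x, polytope_of s x ->
      0 <= last_coord x /\ (last_coord x = 0 -> incone (neg_infties R p) x)].
Proof.
have [h1 h10 h1G] := gens_pole.
elim=> [{}s [ymax ymaxP [Vs QE _ _]]|{}s s' _ [Vs TQ Qlast] [v [x [h [_ _ [_ Th _]]]]]].
  rewrite QE simplexE.
  have hS := @pole_simplex ymax.
  split=> // [x /(TleP _ h1G)[Gx x0]|x /(phull_seq _ hS)[]]; last first.
    by move=> /simplex_last.
  by apply/(phull_seq _ hS); split=> //; exact: gens_simplex.
case=> [Vs' QE _ _]; rewrite QE; split=> // [y Ty|y [/Qlast]//].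
by split; [exact: TQ | exact: Th].
Qed.

Lemma reachable_executable s : reachable Y ybar s ->
  steps_executable (Tle Y) ybar s.
Proof.
have [h0 h00 h0G] := gens_pole; have [L L0 TL] := Tle_hcone.
move=> /reachable_invariant[[[h1 h10 h1V] irr] TQ _] v [vV vis nTv].
have Th1 x : Tle Y x -> 0 < dot h1 x.
  by move=> /TQ/(phull_seq _ h1V)[Vx]; exact: incone_gt0 h1V Vx.
have Ty := interior_subset ybar_int.
split.
- split=> -[c c0 vE].
    apply: nTv; rewrite vE; apply/(TleP _ h0G).
    have /(TleP _ h0G)[Gy y0] := Ty; have [_ _ GZ] := incone_cone gens.
    by split; [apply: GZ => //; exact: ltW | rewrite scaler_eq0 negb_or y0 gt_eqF].
  (* [h1] is positive at both [v] and [ybar], so they cannot be opposite. *)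
  have := h1V v vV; rewrite vE scalerN -scaleNr dotZr ltNge.
  by rewrite mulr_le0_ge0 ?oppr_le0 ?ltW // Th1.
- exact: (crossing_exists_unique L0 TL Th1 ybar_int (h1V v vV) nTv).
- move=> x [_ bx]; split; first exact: (boundary_supporting L0 TL Th1 bx).
  by move=> h _; apply: cut_exists; split=> //; exists h1.
Qed.

Lemma run_terminates : terminates Y ybar.
Proof.
have [h0 h00 h0G] := gens_pole; have [L L0 TL] := Tle_hcone.
have Th0 x : Tle Y x -> 0 < dot h0 x.
  by move=> /(TleP _ h0G)[Gx]; exact: incone_gt0 h0G Gx.
move=> [run [run0 runS]].
have run_reach i : reachable Y ybar (run i).
  by elim: i => [|i IH]; [exact: reachable_init | exact: reachable_step (runS i)].
have /choice[f fP] : forall i,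
    exists w : 'cV[R]_(p + 1) * ('cV[R]_(p + 1) * 'cV[R]_(p + 1)),
    [/\ candidate (Tle Y) (run i) w.1, crossing (Tle Y) ybar w.1 w.2.1,
      supporting (Tle Y) w.2.1 w.2.2 & Defs.cut (run i) w.2.2 (run i.+1)].
  by move=> i; have [v [x [h ?]]] := runS i; exists (v, (x, h)).
have Tx i : Tle Y (f i).2.1.
  by have [_ [_ bx] _ _] := fP i; have [] := (pboundaryP L0 TL Th0 _).1 bx.
have /choice[a aP] : forall i, exists a : 'I_(size gens) -> R,
    (forall j, 0 <= a j) /\ (f i).2.1 = \sum_j a j *: gens`_j.
  move=> i; have /(TleP _ h0G)[/incone_sum[a a0 xE] _] := Tx i.
  by exists a.
(* By the pigeonhole principle, two crossing points have the same support. *)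
have [i [j [ij Sij]]] := nat_finType_collision
  (fun i => [set k | a i k != 0]%SET : {set 'I_(size gens)}).
have [_ _ [hN0 Th hx] _] := fP i.
have [[vV _ nTv] [[c [d [c0 d0 cd xE]] _] _ _]] := fP j.
have hxj : dot (f i).2.2 (f j).2.1 = 0.
  rewrite (aP j).2; apply: (supporting_support _ (aP i).1 _ Sij).
    move=> k; have kG : gens`_k \in gens by rewrite mem_nth.
    suff /Th[] : Tle Y gens`_k by [].
    apply/(TleP _ h0G); split; first exact: mem_incone.
    by apply: contraTneq (h0G _ kG) => ->; rewrite dot0r ltxx.
  by rewrite -(aP i).2.
(* The cut made at step [i] first holds for state [i.+1], hence the offset. *)
have Qsub : forall k, polytope_of (run (i.+1 + k)%N) `<=` phalfspace (f i).2.2.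
  elim=> [|k IH] x; first by rewrite addn0; case: (fP i) => _ _ _ [_ -> _ _] [].
  by rewrite addnS; case: (fP (i.+1 + k)%N) => _ _ _ [_ -> _ _] [/IH].
have hv : 0 <= dot (f i).2.2 (f j).1.
  have [[[h1 _ h1V] _] _ _] := reachable_invariant (run_reach j).
  have /Qsub[//] : polytope_of (run (i.+1 + (j - i.+1))%N) (f j).1.
  rewrite subnKC //; apply/(phull_seq _ h1V); split; first exact: mem_incone.
  by apply: contraTneq (h1V _ vV) => ->; rewrite dot0r ltxx.
have hy : 0 < dot (f i).2.2 ybar.
  by apply: interior_dot_gt0 ybar_int => // x /Th[].
(* The later crossing point is [c *: v + d *: ybar]. Both terms pair nonnegatively with the earlier
   normal and sum to zero, so [d = 0]; then the crossing point is a multiple of [v], which puts [v]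
   in [T^<=]. *)
have := Tx j; move: hxj; rewrite xE dotDr !dotZr => /eqP.
rewrite paddr_eq0 ?mulr_ge0 ?(ltW hy) // => /andP[_].
rewrite mulf_eq0 (gt_eqF hy) orbF => /eqP dE.
move: cd; rewrite dE eqxx orbF scale0r addr0 => cN0 /(TleP _ h0G)[Gv v0].
apply: nTv; apply/(TleP _ h0G).
have [_ _ GZ] := incone_cone gens; split.
  by rewrite -[(f j).1]scale1r -(mulVf cN0) -scalerA; apply: GZ; rewrite ?invr_ge0.
by apply: contraNneq v0 => ->; rewrite scaler0.
Qed.

Lemma reachable_output s : reachable Y ybar s ->
  (forall v, ~ candidate (Tle Y) s v) -> output s = efficient_extreme Y.
Proof.
have [h0 h00 h0G] := gens_pole.
move=> /reachable_invariant[Vs TQ Qlast] noc.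
have [[h1 h10 h1V] _] := Vs.
(* A vertex at infinity is covered by the invariant, a visible one by the absence of candidates. *)
have TV v : v \in verts s -> incone gens v.
  move=> vV; have v0 : v != 0.
    by apply: contraTneq (h1V _ vV) => ->; rewrite dot0r ltxx.
  have Qv : polytope_of s v.
    by apply/(phull_seq _ h1V); split=> //; exact: mem_incone.
  have [+ lv] := Qlast v Qv; rewrite le_eqVlt => /orP[/eqP/esym/lv|vv].
    exact: neg_infties_gens.
  have /(TleP _ h0G)[] // : Tle Y v.
  by apply: contrapT => nTv; apply: (noc v).
have VE : incone (verts s) = incone gens.
  have h0V v : v \in verts s -> 0 < dot h0 v.
    move=> vV; apply: incone_gt0 h0G (TV v vV) _.
    by apply: contraTneq (h1V _ vV) => ->; rewrite dot0r ltxx.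
  apply: (incone_phull_inj h0V h0G); rewrite -TleE; apply/seteqP; split=> // x.
  move=> /(phull_seq _ h0V)[Vx x0]; apply/(TleP _ h0G); split=> //.
  exact: incone_sub Vx.
apply/seteqP; split=> y.
  case=> v [vV vv] <-; apply/efficient_extremeP/vertex_extreme.
  apply: (@extreme_ray_scale _ _ _ (last_coord v)) => //; first exact: incone_cone.
  by rewrite -scale_homog_dehomog // -VE; exact: vertex_list_extreme.
move=> /efficient_extremeP/vertex_extreme ext.
(* An extreme ray must pass through one of the generators, here a listed vertex. *)
have [v vV [c c0 yE]] : exists2 v, v \in verts s &
    exists2 c : R, 0 < c & homog y = c *: v.
  by apply: (extreme_ray_mem (incone_cone gens) TV _ ext); rewrite VE; case: ext.
have vE : v = c^-1 *: homog y by rewrite yE scalerA mulVf ?scale1r // gt_eqF.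
exists v; last by rewrite vE dehomogK // invr_eq0 gt_eqF.
by split=> //; rewrite /visible vE last_coordZ last_homog mulr1 invr_gt0.
Qed.

End Run.

End Algorithm.

Theorem theorem5p5 (R : realType) (m n p : nat)
    (A : 'M[R]_(m, n)) (b : 'cV[R]_m) (C : 'M[R]_(p, n)) :
  feasible A b !=set0 -> bounded_set (feasible A b) ->
  let Y := outcomes A b C in
  let T := Tle Y in
  init_executable Y /\
  forall ybar : 'cV[R]_(p + 1), interior T ybar ->
    [/\ forall s, reachable Y ybar s -> steps_executable T ybar s,
        terminates Y ybar
      & forall s, reachable Y ybar s -> (forall v, ~ candidate T s v) ->
          output s = efficient_extreme Y].
Proof.
move=> X0 bX; have [W Wv YW] := outcomes_generated C X0 bX.
have Y0 : outcomes A b C !=set0 by case: X0 => x Xx; exists (C *m x), x.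
split=> [|ybar ybar_int].
  split; first exact: (Tle_interior_nonempty Wv YW Y0).
  have [ymax ymaxP] := ideal_point_exists Wv YW Y0.
  exact: initial_exists ymaxP.
split=> [s||s].
- exact: (reachable_executable Wv YW Y0 ybar_int).
- exact: (run_terminates Wv YW Y0 ybar_int).
- exact: (reachable_output Wv YW Y0).
Qed.
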